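(* Let $n\ge 1$ and let $\vec\beta$ be a Bell functional in the $(n,2,2)$ scenario. Let $p_{\tilde a}$ be a local deterministic correlation which is the unique classical maximum of $\vec\beta$, i.e. $\vec\beta\cdot p_{\tilde a}>\vec\beta\cdot p$ for every local correlation $p\in\mathcal L$, $p\ne p_{\tilde a}$. Then $p_{\tilde a}$ is a local optimum for $\vec\beta$ in $\mathcal Q_p(2)$.
   Context: In the $(n,2,2)$ scenario, correlations are real vectors $p=(p(a|x))_{a\in\mathbb Z_2^n,\,x\in\mathbb Z_2^n}\in\mathbb R^{2^n\times 2^n}$. A Bell functional is a linear form $\vec\beta\cdot p=\sum_{a,x}\beta_{a,x}\,p(a|x)$ with real coefficients $\beta_{a,x}$. A local deterministic strategy is a family of functions $\tilde a=(\tilde a_i:\mathbb Z_2\to\mathbb Z_2)_{1\le i\le n}$; its local deterministic correlation is $p_{\tilde a}(a|x)=\prod_{i=1}^n\delta_{a_i,\tilde a_i(x_i)}$. The set $\mathcal L$ of local (classical) correlations is the convex hull of the local deterministic correlations. A qubit projective strategy consists of a density operator $\rho$ on $(\mathbb C^2)^{\otimes n}$ and, for each party $i$ and input $x_i\in\mathbb Z_2$, a projective measurement on $\mathbb C^2$, i.e. orthogonal projectors $\Pi^{(i)}_{0|x_i},\Pi^{(i)}_{1|x_i}$ with $\Pi^{(i)}_{0|x_i}+\Pi^{(i)}_{1|x_i}=I$ and $\Pi^{(i)}_{0|x_i}\Pi^{(i)}_{1|x_i}=0$. It realizes $p(a|x)=\mathrm{Tr}\big(\rho\,\Pi^{(1)}_{a_1|x_1}\otimes\cdots\otimes\Pi^{(n)}_{a_n|x_n}\big)$.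 $\mathcal Q_p(2)$ is the set of all correlations realized by such strategies. $p_{\tilde a}$ is a local optimum for $\vec\beta$ in $\mathcal Q_p(2)$ if there is a neighborhood $V$ of $p_{\tilde a}$ in $\mathbb R^{2^n\times2^n}$ such that $\vec\beta\cdot p\le\vec\beta\cdot p_{\tilde a}$ for all $p\in\mathcal Q_p(2)\cap V$. *)

(* Defs.v *)
From mathcomp Require Import all_boot all_order all_algebra.
From mathcomp Require Import all_classical all_reals all_analysis.
From mathcomp Require Import sesquilinear spectral complex.

Set Implicit Arguments.
Unset Strict Implicit.
Unset Printing Implicit Defensive.

Import Order.TTheory GRing.Theory Num.Theory.
Import numFieldNormedType.Exports.

Local Open Scope classical_set_scope.
Local Open Scope complex_scope.
Local Open Scope ring_scope.
Local Open Scope sesquilinear_scope.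

(* Z_2^n; it labels joint inputs, joint outputs, and the computational basis of
   (C^2)^{(x) n}. *)
Notation bits n := {ffun 'I_n -> 'Z_2}.

(* K^(2^n x 2^n), with rows and columns numbered by enum_rank on bits n. The
   same type carries correlations (K = R; rows are outputs, columns are inputs)
   and operators on (C^2)^{(x) n} (K = R[i]). *)
Notation bits_mx K n := 'M[K]_(#|{: bits n}|, #|{: bits n}|).

Definition mk_bits_mx (K : Type) (n : nat) (F : bits n -> bits n -> K) :
    bits_mx K n :=
  \matrix_(i, j) F (enum_val i) (enum_val j).

Definition entry (K : Type) (n : nat) (M : bits_mx K n) (s t : bits n) : K :=
  M (enum_rank s) (enum_rank t).

Section Correlations.
Context {R : realType} {n : nat}.
Implicit Types (beta p : bits_mx R n) (f : 'I_n -> 'Z_2 -> 'Z_2).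

Definition bell beta p : R :=
  \sum_(a : bits n) \sum_(x : bits n) entry beta a x * entry p a x.

Definition det_corr f : bits_mx R n :=
  mk_bits_mx (fun a x => \prod_(i < n) (a i == f i (x i))%:R).

(* The convex hull, as the smallest convex set containing the local
   deterministic correlations. *)
Definition local_corr : set (bits_mx R n) :=
  smallest (@convex_set R (bits_mx R n)) (range det_corr).

Definition unique_classical_max beta f : Prop :=
  forall p, local_corr p -> p <> det_corr f -> bell beta p < bell beta (det_corr f).

End Correlations.

Section Quantum.
Context {R : realType}.
Local Notation C := R[i].

(* In the order of R[i], 0 <= z means that z is real and nonnegative. *)
Definition density_operator (m : nat) (rho : 'M[C]_m) : Prop :=
  [/\ rho \is hermsymmx,
      forall v : 'cV[C]_m, 0 <= (v ^t* *m rho *m v) 0 0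
    & \tr rho = 1].

Definition orthogonal_projector (m : nat) (P : 'M[C]_m) : Prop :=
  P \is hermsymmx /\ P *m P = P.

(* Zero and identity projectors are allowed. *)
Definition projective_measurement (m : nat) (P : 'Z_2 -> 'M[C]_m) : Prop :=
  [/\ orthogonal_projector (P 0), orthogonal_projector (P 1),
      P 0 + P 1 = 1%:M & P 0 *m P 1 = 0].

(* A_1 (x) ... (x) A_n, written in the computational basis. *)
Definition tensor (n : nat) (A : 'I_n -> 'M[C]_2) : bits_mx C n :=
  mk_bits_mx (fun s t => \prod_(i < n) A i (s i) (t i)).

(* Pi i x a is the projector of party i for input x and output a. *)
Definition qubit_corr {n : nat} : set (bits_mx R n) :=
  [set p | exists (rho : bits_mx C n) (Pi : 'I_n -> 'Z_2 -> 'Z_2 -> 'M[C]_2),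
    [/\ density_operator rho,
        forall i x, projective_measurement (Pi i x)
      & forall a x : bits n,
          (entry p a x)%:C = \tr (rho *m tensor (fun i => Pi i (x i) (a i)))]].

Definition local_optimum (n : nat) (beta : bits_mx R n)
    (f : 'I_n -> 'Z_2 -> 'Z_2) : Prop :=
  exists2 V : set (bits_mx R n), nbhs (det_corr f) V &
    forall p, (qubit_corr `&` V) p -> bell beta p <= bell beta (det_corr f).

End Quantum.

(* Main.v *)
Require Import Defs.
From mathcomp Require Import all_boot all_order all_algebra.
From mathcomp Require Import all_classical all_reals all_analysis.
From mathcomp Require Import sesquilinear spectral complex.
From mathcomp Require Import ring lra.

(* Flag by 1 the outputs that depart from the strategy [f], and let [M k y 1] be
   the projector of party [k] for a departure on input [y]. If [p] is close to the
   deterministic point, the two departure projectors of a party either commute or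
   are rank-one projectors of C^2 at a small angle; in both cases they are
   [s]-close to the marginals of a joint measurement [W k] over the four local
   deterministic strategies. Let [eta] be the total departure probability.
   Replacing [M] by [W] in a slot next to another departing party changes a
   probability by at most [s * eta], so [p] agrees, up to O(s * eta), with a
   classical mixture in which the strategies departing at several parties have
   their weight in [W], while those departing at a single party get the exact
   weight seen by [M]: their first-order effect must not be approximated. The
   gap of the unique classical maximum makes the mixture lose at least a constant
   times [eta], which beats the error for small [s]. *)

Set Implicit Arguments.
Unset Strict Implicit.
Unset Printing Implicit Defensive.

Import Order.TTheory GRing.Theory Num.Theory.
Import numFieldNormedType.Exports.

Local Open Scope classical_set_scope.
Local Open Scope complex_scope.
Local Open Scope ring_scope.
Local Open Scope sesquilinear_scope.

(** * Matrices that are sums of Hermitian squares *)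

Section HermitianSquares.
Context {R : realType} {m : nat}.
Local Notation C := R[i].
Implicit Types A B : 'M[C]_m.

(* Positivity as a sum of Hermitian squares passes to tensor products by
   expanding the sums. *)
Definition psd A := exists l : seq 'M[C]_m, A = \sum_(B <- l) B ^t* *m B.

Lemma psd_square B : psd (B ^t* *m B).
Proof. by exists [:: B]; rewrite big_seq1. Qed.

Lemma psd0 : psd 0.
Proof. by exists [::]; rewrite big_nil. Qed.

Lemma psdD A B : psd A -> psd B -> psd (A + B).
Proof. by move=> [l ->] [l' ->]; exists (l ++ l'); rewrite big_cat. Qed.

Lemma psd_sum (I : finType) (P : pred I) (F : I -> 'M[C]_m) :
  (forall i, P i -> psd (F i)) -> psd (\sum_(i | P i) F i).
Proof. by move=> F_psd; apply: (big_ind psd) => //; [exact: psd0 | exact: psdD]. Qed.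

Lemma adjM A B : (A *m B) ^t* = B ^t* *m A ^t*.
Proof. by rewrite trmx_mul map_mxM. Qed.

Lemma adjD A B : (A + B) ^t* = A ^t* + B ^t*.
Proof. by rewrite linearD /= map_mxD. Qed.

Lemma adjB A B : (A - B) ^t* = A ^t* - B ^t*.
Proof. by rewrite linearB /= map_mxB. Qed.

Lemma adj_realZ (a : R) B : (a%:C *: B) ^t* = a%:C *: B ^t*.
Proof.
apply/matrixP => i j; rewrite !mxE rmorphM /=; congr (_ * _).
exact: conjc_real.
Qed.

Lemma psdZ (a : R) A : 0 <= a -> psd A -> psd (a%:C *: A).
Proof.
move=> a0 [l ->]; exists [seq (Num.sqrt a)%:C *: B | B <- l].
rewrite big_map scaler_sumr; apply: eq_bigr => B _.
rewrite adj_realZ -scalemxAl -scalemxAr scalerA; congr (_ *: _).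
by rewrite -rmorphM /= -expr2 sqr_sqrtr.
Qed.

Lemma psd_scalar (a : R) : 0 <= a -> psd (a%:C)%:M.
Proof.
move=> a0; rewrite -scalemx1; apply: psdZ => //.
by have := psd_square 1%:M; rewrite trmx1 map_mx1 mulmx1.
Qed.

Lemma psd1 : psd 1%:M.
Proof. exact: (psd_scalar ler01). Qed.

Lemma hermsymmx_adj A : A \is hermsymmx -> A ^t* = A.
Proof. by move/is_hermitianmxP; rewrite expr0 scale1r => <-. Qed.

Lemma psd_projector A : orthogonal_projector A -> psd A.
Proof.
by case=> /hermsymmx_adj AH AA; rewrite -AA -{1}AH; exact: psd_square.
Qed.

(* [2 s (s + E) = (s + E)^2 + (s^2 - c)] *)
Lemma psd_scalarD (s c : R) A : A ^t* = A -> A *m A = (c%:C)%:M ->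
  0 < s -> c <= s ^+ 2 -> psd ((s%:C)%:M + A).
Proof.
move=> AH AA s0 cs.
set S : 'M[C]_m := (s%:C)%:M.
have SH : S ^t* = S by rewrite /S -scalemx1 adj_realZ trmx1 map_mx1.
have SS : S *m S = ((s ^+ 2)%:C)%:M by rewrite -scalar_mxM -rmorphM.
have SA : S *m A = A *m S by rewrite mul_scalar_mx mul_mx_scalar.
have -> : S + A = (2 * s)^-1%:C *:
    ((S + A) ^t* *m (S + A) + ((s ^+ 2 - c)%:C)%:M).
  rewrite adjD SH AH mulmxDl !mulmxDr AA -SA SS rmorphB raddfB /= -SS.
  have regroup (u v w : 'M[C]_m) : u + v + (v + w) + (u - w) = (u + v) *+ 2.
    by apply/matrixP => i j; rewrite !mxE; ring.
  rewrite regroup -mulmxDr mul_scalar_mx -[RHS]scalerMnr scalerMnl scalerA -rmorphMn.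
  rewrite -rmorphM /= [X in X%:C](_ : _ = 1) ?rmorph1 ?scale1r //.
  by field; rewrite gt_eqF.
apply: psdZ; first by rewrite invr_ge0 mulr_ge0 // ltW.
by apply: psdD; [exact: psd_square | apply: psd_scalar; rewrite subr_ge0].
Qed.

End HermitianSquares.

(** * Tensor products and their expectations in a state *)

Section Functional.
Context {R : realType} {n : nat}.
Local Notation C := R[i].
Implicit Types (rho : bits_mx C n) (A B : 'I_n -> 'M[C]_2) (X Y : 'M[C]_2).

Definition set_slot A (k : 'I_n) X (i : 'I_n) := if i == k then X else A i.

Lemma set_slot_id A k : set_slot A k (A k) = A.
Proof. by apply/funext => i; rewrite /set_slot; case: eqP => [->|]. Qed.

Lemma set_slotxx A k X : set_slot A k X k = X.
Proof. by rewrite /set_slot eqxx. Qed.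

Lemma tensor_sum (I : finType) (P : 'I_n -> pred I) (F : 'I_n -> I -> 'M[C]_2) :
  tensor (fun i => \sum_(c | P i c) F i c)
  = \sum_(h in family P) tensor (fun i => F i (h i)).
Proof.
apply/matrixP => s t; rewrite summxE mxE.
under eq_bigr do rewrite summxE.
by rewrite bigA_distr_big_dep; apply: eq_bigr => h _; rewrite mxE.
Qed.

Lemma tensor_slotE A k X s t : tensor (set_slot A k X) s t =
  X (enum_val s k) (enum_val t k)
  * \prod_(i < n | i != k) A i (enum_val s i) (enum_val t i).
Proof.
rewrite mxE (bigD1 k) //= set_slotxx; congr (_ * _).
by apply: eq_bigr => i /negPf ik; rewrite /set_slot ik.
Qed.

Lemma tensor_slotD A k X Y :
  tensor (set_slot A k (X + Y)) = tensor (set_slot A k X) + tensor (set_slot A k Y).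
Proof. by apply/matrixP => s t; rewrite [RHS]mxE !tensor_slotE mxE mulrDl. Qed.

Lemma tensor_slotZ A k (a : C) X :
  tensor (set_slot A k (a *: X)) = a *: tensor (set_slot A k X).
Proof. by apply/matrixP => s t; rewrite [RHS]mxE !tensor_slotE mxE mulrA. Qed.

Lemma tensorM A B : tensor A *m tensor B = tensor (fun i => A i *m B i).
Proof.
apply/matrixP => s t; rewrite !mxE.
under [RHS]eq_bigr do rewrite mxE.
rewrite bigA_distr_bigA /= (reindex enum_rank) /=; last first.
  by exists enum_val => x _; [exact: enum_rankK | exact: enum_valK].
by apply: eq_bigr => h _; rewrite !mxE enum_rankK -big_split.
Qed.

Lemma tensor_adj A : (tensor A) ^t* = tensor (fun i => (A i) ^t*).
Proof.
by apply/matrixP => s t; rewrite !mxE rmorph_prod; apply: eq_bigr => i _; rewrite !mxE.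
Qed.

Lemma tensor1 : tensor (fun=> 1%:M) = 1%:M :> bits_mx C n.
Proof.
apply/matrixP => s t; rewrite !mxE -(inj_eq enum_val_inj).
have [->|/eqP st] := eqVneq; first by rewrite big1 // => i _; rewrite mxE eqxx.
have [i sti] : exists i, enum_val s i != enum_val t i.
  by apply/existsP; apply: contra_notT st => /existsPn eq_st;
     apply/ffunP => i; apply/eqP; have := eq_st i; rewrite negbK.
by rewrite (bigD1 i) //= mxE (negPf sti) mul0r.
Qed.

Lemma ReD (z w : C) : complex.Re (z + w) = complex.Re z + complex.Re w.
Proof. by case: z w => [a b] [c d]. Qed.

Lemma Re_realM (a : R) (z : C) : complex.Re (a%:C * z) = a * complex.Re z.
Proof. by case: z => [b c] /=; rewrite mul0r subr0. Qed.

(** The real part makes the values real numbers; for a state and Hermitian factors the trace is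
    already real. *)
Definition qexp rho A : R := complex.Re (\tr (rho *m tensor A)).

Lemma qexp_sum rho (I : finType) (P : 'I_n -> pred I) (F : 'I_n -> I -> 'M[C]_2) :
  qexp rho (fun i => \sum_(c | P i c) F i c)
  = \sum_(h in family P) qexp rho (fun i => F i (h i)).
Proof.
rewrite /qexp tensor_sum mulmx_sumr (raddf_sum (@mxtrace C _)).
by rewrite (big_morph _ ReD (erefl : complex.Re (0 : C) = 0)).
Qed.

Lemma qexp_slotD rho A k X Y : qexp rho (set_slot A k (X + Y))
  = qexp rho (set_slot A k X) + qexp rho (set_slot A k Y).
Proof. by rewrite /qexp tensor_slotD mulmxDr raddfD ReD. Qed.

Lemma qexp_slotZ rho A k (a : R) X :
  qexp rho (set_slot A k (a%:C *: X)) = a * qexp rho (set_slot A k X).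
Proof. by rewrite /qexp tensor_slotZ -scalemxAr linearZ Re_realM. Qed.

Lemma qexp_slotB rho A k X Y : qexp rho (set_slot A k (X - Y))
  = qexp rho (set_slot A k X) - qexp rho (set_slot A k Y).
Proof.
have -> : - Y = (-1)%:C *: Y by rewrite rmorphN rmorph1 scaleN1r.
by rewrite qexp_slotD qexp_slotZ mulN1r.
Qed.

Section State.
Variable rho : bits_mx C n.
Hypothesis rho_state : density_operator rho.
Local Notation L := (qexp rho).

Lemma qexp1 : L (fun=> 1%:M) = 1.
Proof. by case: rho_state => _ _ tr1; rewrite /qexp tensor1 mulmx1 tr1. Qed.

(** By cyclicity the trace is a sum, over the rows of [B], of the quadratic form of [rho] at the
    adjoint rows. *)
Lemma tr_square_ge0 (B : bits_mx C n) : 0 <= \tr (rho *m (B ^t* *m B)).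
Proof.
case: rho_state => _ rho_ge0 _.
rewrite mulmxA mxtrace_mulC mulmxA; apply: sumr_ge0 => i _.
have := rho_ge0 ((row i B) ^t*).
rewrite trmxCK -row_mul; congr (0 <= _); rewrite mxE [RHS]mxE.
by apply: eq_bigr => j _; rewrite [row _ _ _ _]mxE; congr (_ * _); rewrite !mxE.
Qed.

(** Multilinearity expands a product of sums of squares into a sum of squares of tensor products. *)
Lemma qexp_ge0 A : (forall i, psd (A i)) -> 0 <= L A.
Proof.
move=> /choice [l Al].
(* The lists of squares differ in length from slot to slot; the common bound [N] gives them one
   index type, cut by a predicate. *)
pose N := (\max_i size (l i))%N.
have -> : A = fun i => \sum_(j < N | (j < size (l i))%N) (nth 0 (l i) j) ^t* *m nth 0 (l i) j.
  apply/funext => i; rewrite Al (big_nth 0) big_mkord.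
  rewrite (big_ord_widen_cond N xpredT (fun j => (nth 0 (l i) j) ^t* *m nth 0 (l i) j)) //.
  exact: leq_bigmax.
rewrite qexp_sum; apply: sumr_ge0 => h _; rewrite /qexp.
rewrite -tensorM -tensor_adj.
have := tr_square_ge0 (tensor (fun i => nth 0 (l i) (h i))).
by rewrite lecE => /andP[].
Qed.

(** Hybrid argument: the slots pass from [A] to [B] one at a time, from the left. *)
Lemma qexp_telescope A B : L A - L B =
  \sum_(k < n) L (set_slot (fun i => if (i < k)%N then B i else A i) k (A k - B k)).
Proof.
pose hyb m (i : 'I_n) := if (i < m)%N then B i else A i.
have hyb0 : hyb 0%N = A by [].
have hybn : hyb n = B by apply/funext => i; rewrite /hyb ltn_ord.
have -> : L A - L B = \sum_(k < n) (L (hyb k) - L (hyb k.+1)).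
  rewrite -[LHS]opprB -{1}hyb0 -hybn -(telescope_sumr (fun m => L (hyb m))) //.
  by rewrite -sumrN big_mkord; apply: eq_bigr => k _; rewrite opprB.
apply: eq_bigr => k _; rewrite qexp_slotB.
rewrite -[hyb k in LHS](set_slot_id _ k) {2}/hyb ltnn; congr (_ - qexp _ _).
apply/funext => i; rewrite /hyb /set_slot ltnS leq_eqVlt val_eqE.
by have [->|ik] := eqVneq i k.
Qed.

Lemma ler_qexp A B : (forall i, psd (A i)) -> (forall i, psd (B i - A i)) -> L A <= L B.
Proof.
move=> A0 AB; rewrite -subr_ge0 qexp_telescope; apply: sumr_ge0 => k _.
apply: qexp_ge0 => i; rewrite /set_slot; case: eqP => _; first exact: AB.
by case: ifP => // _; rewrite -(subrK (A i) (B i)); apply: psdD.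
Qed.

(** The bound is asked for every mixture [H] of [A] and [B], so that the order of replacement can be
    ignored. *)
Lemma qexp_dist A B (e : R) :
  (forall k H, (forall i, H i = A i \/ H i = B i) ->
    `|L (set_slot H k (A k - B k))| <= e) ->
  `|L A - L B| <= n%:R * e.
Proof.
move=> step; rewrite qexp_telescope.
rewrite (le_trans (ler_norm_sum _ _ _)) //.
rewrite -[n in n%:R]card_ord -sum1_card natr_sum mulr_suml ler_sum // => k _.
by rewrite mul1r; apply: step => i; case: ifP; [right|left].
Qed.

(** Second-order estimate: [D], between [-s] and [s], costs a factor [s], slot [j] keeps an operator
    below [X], and the other slots are bounded by the identity. With a departure operator as [X],
    the error is [s] times a departure probability. *)
Lemma qexp_slot_le (H : 'I_n -> 'M[C]_2) (k j : 'I_n) (s : R) (D X : 'M[C]_2) :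
  j != k -> 0 <= s ->
  psd ((s%:C)%:M + D) -> psd ((s%:C)%:M - D) ->
  (forall i, i != k -> psd (H i)) -> psd (X - H j) ->
  (forall i, i != k -> i != j -> psd (1%:M - H i)) ->
  `|L (set_slot H k D)| <= s * L (set_slot (fun=> 1%:M) j X).
Proof.
move=> jk s0 sD sD' H0 HX H1.
have L1 : L (set_slot H k 1%:M) <= L (set_slot (fun=> 1%:M) j X).
  apply: ler_qexp => i; rewrite /set_slot.
    by case: eqP => [_|/eqP /H0 //]; exact: psd1.
  have [->|ik] := eqVneq i k; first by rewrite eq_sym (negPf jk) subrr; exact: psd0.
  by case: eqP => [->//|/eqP]; exact: H1.
have slot_ge0 Z : psd Z -> 0 <= L (set_slot H k Z).
  by move=> Z0; apply: qexp_ge0 => i; rewrite /set_slot; case: eqP => [//|/eqP]; exact: H0.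
have := slot_ge0 _ sD; have := slot_ge0 _ sD'.
rewrite qexp_slotB qexp_slotD -(scalemx1 _ s%:C) qexp_slotZ => D1 D2.
rewrite ler_norml; apply/andP; split.
  rewrite lerNl -[leLHS]add0r lerBlDr.
  by apply: (le_trans D2); rewrite lerD2r ler_wpM2l.
by rewrite (le_trans _ (ler_wpM2l s0 L1)) // -subr_ge0.
Qed.

End State.
End Functional.

Lemma Z2P (b : 'Z_2) : b = 0 \/ b = 1.
Proof. by case: b => [[|[|m]] mlt]; [left | right | by []]; apply/val_inj. Qed.

Lemma sum_Z2 (V : nmodType) (F : 'Z_2 -> V) : \sum_c F c = F 0 + F 1.
Proof.
rewrite (bigD1 (0 : 'Z_2)) //= (bigD1 (1 : 'Z_2)) //= big1 ?addr0 // => c.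
by have [->|->] := Z2P c.
Qed.

Lemma sum_Z2xZ2 (V : nmodType) (F : 'Z_2 * 'Z_2 -> V) :
  \sum_c F c = F (0, 0) + F (0, 1) + (F (1, 0) + F (1, 1)).
Proof.
rewrite (eq_bigr (fun c => F (c.1, c.2))) => [|[]//].
by rewrite -(pair_bigA _ (fun a b => F (a, b))) /= !sum_Z2.
Qed.

(** * Joint measurements approximating the two measurements of a party *)

Section JointMeasurement.
Context {R : realType}.
Local Notation C := R[i].

(** A pair lists the values of a function on ['Z_2]; [0] is the strategy that never departs. *)
Definition response (c : 'Z_2 * 'Z_2) (y : 'Z_2) : 'Z_2 := if y == 0 then c.1 else c.2.

Definition marginal (W : 'Z_2 * 'Z_2 -> 'M[C]_2) (y b : 'Z_2) : 'M[C]_2 :=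
  \sum_(c | response c y == b) W c.

Record binary_measurements (M : 'Z_2 -> 'Z_2 -> 'M[C]_2) : Prop := BinaryMeasurements {
  measurement_psd : forall y b, psd (M y b);
  measurement_sum : forall y, M y 0 + M y 1 = 1%:M }.

(* [W] is a joint measurement whose marginals are [s]-close to [M]; outcome [1]
   of [M y] means that the party departs from the deterministic strategy. *)
Record joint_approx (s : R) (M : 'Z_2 -> 'Z_2 -> 'M[C]_2)
    (W : 'Z_2 * 'Z_2 -> 'M[C]_2) : Prop := JointApprox {
  joint_measured :> binary_measurements M;
  joint_psd : forall c, psd (W c);
  joint_sum : \sum_c W c = 1%:M;
  joint_close : forall y b, psd ((s%:C)%:M + (M y b - marginal W y b));
  joint_dominated : psd (M 0 1 + M 1 1 - (1%:M - W 0)) }.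

Section Theory.
Variables (s : R) (M : 'Z_2 -> 'Z_2 -> 'M[C]_2) (W : 'Z_2 * 'Z_2 -> 'M[C]_2).
Hypothesis MW : joint_approx s M W.

Lemma measurement_le1 y b : psd (1%:M - M y b).
Proof.
have [->|->] := Z2P b; rewrite -(measurement_sum MW y).
  by rewrite addrAC subrr add0r; exact: measurement_psd MW _ _.
by rewrite addrK; exact: measurement_psd MW _ _.
Qed.

Lemma measurement_le_dom y : psd (M 0 1 + M 1 1 - M y 1).
Proof.
have [->|->] := Z2P y; first by rewrite addrAC subrr add0r; exact: measurement_psd MW _ _.
by rewrite addrK; exact: measurement_psd MW _ _.
Qed.

Lemma marginal_psd y b : psd (marginal W y b).
Proof. by apply: psd_sum => c _; exact: joint_psd MW c. Qed.

Lemma marginal_sum y : marginal W y 0 + marginal W y 1 = 1%:M.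
Proof.
rewrite -(joint_sum MW) [RHS](bigID (fun c => response c y == 0)) /=; congr (_ + _).
by apply: eq_bigl => c; have [->|->] := Z2P (response c y).
Qed.

Lemma marginal_le1 y b : psd (1%:M - marginal W y b).
Proof.
have [->|->] := Z2P b; rewrite -(marginal_sum y).
  by rewrite addrAC subrr add0r; exact: marginal_psd.
by rewrite addrK; exact: marginal_psd.
Qed.

Lemma response0 y : response 0 y = 0.
Proof. by rewrite /response; case: ifP. Qed.

Lemma joint0_le_marginal y : psd (marginal W y 0 - W 0).
Proof.
rewrite /marginal (bigD1 (0 : 'Z_2 * 'Z_2)) ?response0 //= addrAC subrr add0r.
by apply: psd_sum => c _; exact: joint_psd MW c.
Qed.

Lemma joint0_le1 : psd (1%:M - W 0).
Proof.
rewrite -(joint_sum MW). rewrite (bigD1 (0 : 'Z_2 * 'Z_2)) //= addrAC subrr add0r.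
by apply: psd_sum => c _; exact: joint_psd MW c.
Qed.

(** [1%:M - W 0] gathers the strategies that depart on some input, so it dominates [marginal W y 1];
    [joint_dominated] then passes to the projectors of [M]. *)
Lemma marginal_le_dom y : psd (M 0 1 + M 1 1 - marginal W y 1).
Proof.
have -> : marginal W y 1 = 1%:M - marginal W y 0 by rewrite -(marginal_sum y) addrAC subrr add0r.
have -> : M 0 1 + M 1 1 - (1%:M - marginal W y 0)
    = (M 0 1 + M 1 1 - (1%:M - W 0)) + (marginal W y 0 - W 0).
  by apply/matrixP => i j; rewrite !mxE; ring.
by apply: psdD; [exact: joint_dominated MW | exact: joint0_le_marginal].
Qed.

Lemma marginal_joint0_le_dom y : psd (M 0 1 + M 1 1 - (marginal W y 0 - W 0)).
Proof.
have -> : M 0 1 + M 1 1 - (marginal W y 0 - W 0)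
   = (M 0 1 + M 1 1 - (1%:M - W 0)) + marginal W y 1.
  by rewrite -(marginal_sum y); apply/matrixP => i j; rewrite !mxE; ring.
by apply: psdD; [exact: joint_dominated MW | exact: marginal_psd].
Qed.

(** Flipping [b] changes the sign of the difference, both measurements being complete, so the
    one-sided bounds of [joint_close] are two-sided. *)
Lemma joint_close_opp y b : psd ((s%:C)%:M - (M y b - marginal W y b)).
Proof.
have -> : - (M y b - marginal W y b) = M y (1 - b) - marginal W y (1 - b).
  rewrite opprB; apply/eqP; rewrite subr_eq addrAC eq_sym subr_eq; apply/eqP.
  have [->|->] := Z2P b; rewrite ?subr0 ?subrr ?[M y 1 + _]addrC
    ?[marginal W y 1 + _]addrC; by rewrite (measurement_sum MW) marginal_sum.
exact: joint_close MW _ _.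
Qed.

End Theory.
End JointMeasurement.

(** * Outcome probabilities and departure marginals *)

Section Outcomes.
Context {R : realType} {n : nat}.
Local Notation C := R[i].
Variables (rho : bits_mx C n) (M : 'I_n -> 'Z_2 -> 'Z_2 -> 'M[C]_2).
Hypothesis rho_state : density_operator rho.
Hypothesis M_meas : forall k, binary_measurements (M k).
Local Notation L := (qexp rho).
Implicit Types x b : bits n.

Definition qprob x b := L (fun i => M i (x i) (b i)).

Lemma slot_measurement_ge0 k y (b : 'Z_2) : 0 <= L (set_slot (fun=> 1%:M) k (M k y b)).
Proof.
apply: qexp_ge0 => // i; rewrite /set_slot.
by case: eqP => _; [exact: measurement_psd (M_meas k) _ _ | exact: psd1].
Qed.

Lemma measurement_pick k y (P : pred 'Z_2) :
  \sum_(c | P c) M k y c = (if P 0 then M k y 0 else 0) + (if P 1 then M k y 1 else 0).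
Proof. by rewrite big_mkcond sum_Z2. Qed.

(** No-signalling: the identity in a slot other than [k] is the sum of both outcomes of any
    measurement there, so only [x k] matters on the left. *)
Lemma slot_measurement_expand k x :
  L (set_slot (fun=> 1%:M) k (M k (x k) 1)) = \sum_(b : bits n | b k == 1) qprob x b.
Proof.
have -> : set_slot (fun=> 1%:M) k (M k (x k) 1)
    = fun i => \sum_(c | (i == k) ==> (c == 1)) M i (x i) c.
  apply/funext => i; rewrite /set_slot measurement_pick.
  have [->|_] := eqVneq i k; first by rewrite add0r.
  by rewrite (measurement_sum (M_meas i)).
rewrite qexp_sum; apply: eq_bigl => b; apply/familyP/idP => [/(_ k)|bk i].
  by rewrite -topredE /= eqxx.
by rewrite -topredE /=; apply/implyP => /eqP ->.
Qed.

Lemma qprob_total x : \sum_b qprob x b = 1.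
Proof.
rewrite -(qexp1 rho_state).
have -> : (fun=> 1%:M) = fun i => \sum_(c | true) M i (x i) c.
  by apply/funext => i; rewrite measurement_pick (measurement_sum (M_meas i)).
by rewrite qexp_sum; apply: eq_bigl => b; apply/esym/familyP.
Qed.

Lemma qprob_ge0 x b : 0 <= qprob x b.
Proof. by apply: qexp_ge0 => // i; exact: measurement_psd (M_meas i) _ _. Qed.

Lemma slot_le_complement k x :
  L (set_slot (fun=> 1%:M) k (M k (x k) 1)) <= 1 - qprob x 0.
Proof.
rewrite slot_measurement_expand -(qprob_total x) [leRHS](_ : _ = \sum_(b : bits n | b != 0) qprob x b).
  rewrite big_mkcond [leRHS]big_mkcond; apply: ler_sum => b _.
  have := qprob_ge0 x b; case: eqP => // bk; case: eqP => // b0.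
  by move: bk; rewrite b0 ffunE => /eqP; rewrite eq_sym oner_eq0.
by rewrite (bigD1 (0 : bits n)) //= addrAC subrr add0r.
Qed.

End Outcomes.

(** * Comparison of the quantum probabilities with a classical model *)

Section Approximation.
Context {R : realType} {n : nat}.
Local Notation C := R[i].
Variables (rho : bits_mx C n) (s : R).
Variables (M : 'I_n -> 'Z_2 -> 'Z_2 -> 'M[C]_2) (W : 'I_n -> 'Z_2 * 'Z_2 -> 'M[C]_2).
Hypothesis rho_state : density_operator rho.
Hypothesis s_ge0 : 0 <= s.
Hypothesis MW : forall k, joint_approx s (M k) (W k).
Let M_meas k : binary_measurements (M k) := joint_measured (MW k).
Local Notation L := (qexp rho).
Local Notation qprob := (qprob rho M).
Implicit Types (x b : bits n) (h : {ffun 'I_n -> 'Z_2 * 'Z_2}).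

Definition flags h x : bits n := [ffun i => response (h i) (x i)].
Definition single_flag (k : 'I_n) : bits n := [ffun i => (i == k)%:R].
(** For [0 < n] this says that at least two components of [h] are nonzero; in this form, a departing
    party remains whichever [k] is set aside. *)
Definition multiple h := [forall k, exists j, (j != k) && (h j != 0)].

Definition joint_weight h := L (fun i => W i (h i)).
Definition single_weight k y := L (set_slot (fun i => W i 0) k (M k y 1)).
(** The [eta] of the error bounds. The identities in the other slots make each term a marginal. *)
Definition departure := \sum_(k < n) \sum_y L (set_slot (fun=> 1%:M) k (M k y 1)).

(* Strategies departing at several parties keep their weight in [W]; those
   departing at one party are reweighted so as to match [M] exactly. *)
Definition model x b :=
  \sum_(h | multiple h && (flags h x == b)) joint_weight h
  + \sum_(k | b == single_flag k) single_weight k (x k).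

Lemma joint_weight_ge0 h : 0 <= joint_weight h.
Proof. by apply: qexp_ge0 => // i; exact: joint_psd (MW i) _. Qed.

Lemma single_weight_ge0 k y : 0 <= single_weight k y.
Proof.
apply: qexp_ge0 => // i; rewrite /set_slot.
by case: eqP => _; [exact: measurement_psd (MW k) _ _ | exact: joint_psd (MW i) _].
Qed.

Lemma slot_le_departure k : L (set_slot (fun=> 1%:M) k (M k 0 1 + M k 1 1)) <= departure.
Proof.
rewrite /departure (bigD1 k) //= qexp_slotD.
rewrite sum_Z2 lerDl; apply: sumr_ge0 => j _; apply: sumr_ge0 => y _.
exact: (slot_measurement_ge0 rho_state M_meas).
Qed.

Lemma qexp_close_le (H : 'I_n -> 'M[C]_2) (k j : 'I_n) (y b : 'Z_2) :
  j != k ->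
  (forall i, i != k -> psd (H i)) -> psd (M j 0 1 + M j 1 1 - H j) ->
  (forall i, i != k -> i != j -> psd (1%:M - H i)) ->
  `|L (set_slot H k (M k y b - marginal (W k) y b))| <= s * departure.
Proof.
move=> jk H0 HX H1; apply: (le_trans (qexp_slot_le rho_state jk s_ge0 _ _ H0 HX H1)).
- exact: joint_close (MW k) _ _.
- exact: joint_close_opp (MW k) _ _.
- by apply: ler_wpM2l => //; exact: slot_le_departure.
Qed.

Lemma departure_ge0 : 0 <= departure.
Proof.
apply: sumr_ge0 => j _; apply: sumr_ge0 => y _.
exact: (slot_measurement_ge0 rho_state M_meas).
Qed.

Lemma qexp_slot0 (H : 'I_n -> 'M[C]_2) k : L (set_slot H k 0) = 0.
Proof. by rewrite -(subrr 0) qexp_slotB subrr. Qed.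

(** Whichever slot is being replaced, another one carries outcome 1, of [M] or of [marginal]: a
    departure operator for the second-order estimate. *)
Lemma qprob_near_marginal x b :
  (forall k, exists2 j, j != k & b j = 1) ->
  `|qprob x b - L (fun i => marginal (W i) (x i) (b i))| <= n%:R * (s * departure).
Proof.
move=> b_multi; apply: qexp_dist => // k H HE; have [j jk bj] := b_multi k.
apply: (qexp_close_le (j := j)) => //.
- move=> i _; case: (HE i) => ->; [exact: measurement_psd (MW i) _ _|].
  exact: marginal_psd (MW i) _ _.
- case: (HE j) => ->; rewrite bj; [exact: measurement_le_dom (MW j) _|].
  exact: marginal_le_dom (MW j) _.
- move=> i _ _; case: (HE i) => ->; [exact: measurement_le1 (MW i) _ _|].
  exact: marginal_le1 (MW i) _ _.
Qed.

(** Slot [k] is left untouched and supplies the departure operator for each replacement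
    elsewhere. *)
Lemma qprob_near_slot x k :
  `|qprob x (single_flag k)
     - L (set_slot (fun i => marginal (W i) (x i) 0) k (M k (x k) 1))|
   <= n%:R * (s * departure).
Proof.
have eta0 := mulr_ge0 s_ge0 departure_ge0.
apply: qexp_dist => // l H HE; rewrite {2}/set_slot !ffunE.
have [->|lk] := eqVneq l k; first by rewrite subrr qexp_slot0 normr0.
apply: (qexp_close_le (j := k)) => //; first by rewrite eq_sym.
- move=> i _; case: (HE i) => ->; first exact: measurement_psd (MW i) _ _.
  rewrite /set_slot; case: eqP => _; first exact: measurement_psd (MW _) _ _.
  exact: marginal_psd (MW i) _ _.
- case: (HE k) => ->; rewrite ?set_slotxx ?ffunE ?eqxx; exact: measurement_le_dom (MW k) _.
- move=> i _ _; case: (HE i) => ->; first exact: measurement_le1 (MW i) _ _.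
  rewrite /set_slot; case: eqP => _; first exact: measurement_le1 (MW _) _ _.
  exact: marginal_le1 (MW i) _ _.
Qed.

(** The roles are exchanged: when slot [l] is replaced, its difference [marginal - W 0] is the
    departure operator, and [D] in slot [k] is the factor of size [s]. *)
Lemma slot_marginal_near_joint0 x k D : D = M k (x k) 1 - marginal (W k) (x k) 1 ->
  `|L (set_slot (fun i => marginal (W i) (x i) 0) k D) - L (set_slot (fun i => W i 0) k D)|
   <= n%:R * (s * departure).
Proof.
move=> DE; have eta0 := mulr_ge0 s_ge0 departure_ge0.
apply: qexp_dist => // l H HE.
have [->|lk] := eqVneq l k; first by rewrite !set_slotxx subrr qexp_slot0 normr0.
rewrite [X in set_slot H l X](_ : _ = marginal (W l) (x l) 0 - W l 0); last first.
  by rewrite /set_slot (negPf lk).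
set H' := set_slot H l _.
have -> : H' = set_slot H' k D.
  apply/funext => i; rewrite /set_slot; case: eqP => // ->.
  by rewrite /H' /set_slot [k == l]eq_sym (negPf lk); case: (HE k) => ->; rewrite set_slotxx.
rewrite DE.
have HE' i : i != k -> H i = marginal (W i) (x i) 0 \/ H i = W i 0.
  by move=> /negPf ik; case: (HE i) => ->; rewrite /set_slot ik; [left|right].
apply: (qexp_close_le (j := l)) => //.
- move=> i ik; rewrite /H' /set_slot; case: eqP => _; first exact: joint0_le_marginal (MW _) _.
  by case: (HE' i ik) => ->; [exact: marginal_psd (MW i) _ _ | exact: joint_psd (MW i) _].
- by rewrite /H' set_slotxx; exact: marginal_joint0_le_dom (MW l) _.
- move=> i ik /negPf il; rewrite /H' /set_slot il.
  by case: (HE' i ik) => ->; [exact: marginal_le1 (MW i) _ _ | exact: joint0_le1 (MW i)].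
Qed.

Lemma marginal_expand x b : L (fun i => marginal (W i) (x i) (b i))
  = \sum_(h | flags h x == b) joint_weight h.
Proof.
rewrite qexp_sum; apply: eq_bigl => h; apply/familyP/eqP => [hx|<- i].
  by apply/ffunP => i; rewrite ffunE; apply/eqP; exact: hx.
by apply/eqP; rewrite ffunE.
Qed.

Lemma single_flag_inj : injective single_flag.
Proof.
by move=> k l /ffunP /(_ k); rewrite !ffunE eqxx; case: eqP.
Qed.

(** Two or more flags only come from strategies departing at several parties. A single flag at [k]
    also comes from those departing at [k] alone, whose weight in [W] is exchanged for the exact
    one. *)
Lemma qprob_near_model x b : b != 0 ->
  `|qprob x b - model x b| <= 2 * n%:R * (s * departure).
Proof.
move=> b0; have eta0 := mulr_ge0 s_ge0 departure_ge0.
have [/existsP[k /eqP bk]|] := boolP [exists k, b == single_flag k]; last first.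
  move=> /existsPn b_multi.
  have {}b_multi k : exists2 j, j != k & b j = 1.
    have [i bi] : exists i, b i != 0.
      apply/existsP; apply: contraNT b0 => /existsPn bi; apply/eqP/ffunP => i.
      by rewrite ffunE; apply/eqP; rewrite -[_ == _]negbK; exact: bi.
    have bi1 j : b j != 0 -> b j = 1 by have [->|] := Z2P (b j).
    have [ik|] := eqVneq i k; last by exists i => //; exact: bi1.
    have /existsP[j /andP[jk bj]] : [exists j, (j != k) && (b j != 0)].
      apply: contraNT (b_multi k) => /existsPn bj; apply/eqP/ffunP => j; rewrite ffunE.
      have := bj j; rewrite negb_and !negbK; case: eqP => [->|] /=; last by move=> _ /eqP.
      by rewrite -ik bi1.
    by exists j => //; exact: bi1.
  have -> : model x b = L (fun i => marginal (W i) (x i) (b i)).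
    rewrite /model [X in _ + X]big1 ?addr0; last first.
      move=> k /eqP bk; have [j /negPf jk] := b_multi k.
      by rewrite bk ffunE jk => /eqP; rewrite eq_sym oner_eq0.
    rewrite marginal_expand; apply: eq_bigl => h; case: eqP => [hx|_]; rewrite ?andbF //.
    rewrite andbT; apply/forallP => k; have [j jk bj] := b_multi k.
    apply/existsP; exists j; rewrite jk /=; apply: contra_eq_neq bj => hj.
    by rewrite -hx ffunE hj response0 eq_sym oner_neq0.
  apply: le_trans (qprob_near_marginal x b_multi) _.
  by have := mulr_ge0 (ler0n R n) eta0; lra.
(* The strategies departing at [k] alone contribute the product of the [W i 0] with the marginal in
   slot [k]; trading them for [single_weight] adds the difference in slot [k]. *)
have -> : model x b = L (set_slot (fun i => marginal (W i) (x i) 0) k (marginal (W k) (x k) 1))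
  + L (set_slot (fun i => W i 0) k (M k (x k) 1 - marginal (W k) (x k) 1)).
  rewrite qexp_slotB addrCA addrC /model bk.
  rewrite (big_pred1 k) => [|l]; last by rewrite eq_sym (inj_eq single_flag_inj).
  congr (_ + _).
  have -> : set_slot (fun i => marginal (W i) (x i) 0) k (marginal (W k) (x k) 1)
      = fun i => marginal (W i) (x i) (single_flag k i).
    by apply/funext => i; rewrite /set_slot ffunE; case: eqP => [->|].
  have -> : set_slot (fun i => W i 0) k (marginal (W k) (x k) 1) =
     fun i => \sum_(c | if i == k then response c (x k) == 1 else c == 0) W i c.
    apply/funext => i; rewrite /set_slot; case: eqP => [->//|_].
    by rewrite big_pred1_eq.
  rewrite marginal_expand qexp_sum [in RHS](bigID multiple) /=.
  under [in LHS]eq_bigl do rewrite andbC.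
  rewrite -addrA -[LHS]addr0; congr (_ + _); apply/eqP; rewrite eq_sym subr_eq0.
  apply/eqP; apply: eq_bigl => h; apply/andP/familyP.
    move=> [/eqP hx]; rewrite negb_forall => /existsP[l]; rewrite negb_exists => /forallP hl i.
    have lk : l = k.
      apply/eqP; apply: contraT => lk; have := hl k.
      rewrite eq_sym lk /= negbK => /eqP hk; have := congr1 (fun b : bits n => b k) hx.
      by rewrite !ffunE eqxx hk response0 => /esym/eqP; rewrite oner_eq0.
    rewrite -topredE /=; case: eqP => [->|/eqP ik].
      by have := congr1 (fun b : bits n => b k) hx; rewrite !ffunE eqxx => ->.
    by have := hl i; rewrite lk ik negbK.
  move=> hP; split.
    apply/eqP/ffunP => i; rewrite !ffunE; have := hP i; rewrite -topredE /=.
    case: eqP => [-> /eqP //|_ /eqP ->]; exact: response0.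
  rewrite negb_forall; apply/existsP; exists k; rewrite negb_exists; apply/forallP => j.
  by have := hP j; rewrite -topredE /=; case: eqP => //= _ ->.
rewrite bk; set D := M k (x k) 1 - _.
have := slot_marginal_near_joint0 (erefl D); have := qprob_near_slot x k.
have -> : L (set_slot (fun i => marginal (W i) (x i) 0) k (M k (x k) 1)) =
   L (set_slot (fun i => marginal (W i) (x i) 0) k (marginal (W k) (x k) 1))
   + L (set_slot (fun i => marginal (W i) (x i) 0) k D).
  by rewrite -qexp_slotD subrKC.
set m := L _; set d := L _; set d' := L _ => near_slot near_joint0.
(* [d] restores the exact projector in slot [k] next to marginals, [d'] does so next to [W i 0];
   each of the two errors is at most [n * s * eta]. *)
have -> : qprob x (single_flag k) - (m + d') = (qprob x (single_flag k) - (m + d)) + (d - d').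
  by rewrite !opprD !addrA subrK.
rewrite -mulrA mulr_natl mulr2n; apply: le_trans (ler_normD _ _) _; exact: lerD.
Qed.

(** Both inputs of each party are counted, whereas [model x] meets only the single weight at
    [x k]. *)
Definition model_mass :=
  \sum_(h | multiple h) joint_weight h + \sum_(k < n) \sum_y single_weight k y.

Lemma model_sum (g : bits n -> R) x : \sum_b g b * model x b =
  \sum_(h | multiple h) g (flags h x) * joint_weight h
  + \sum_(k < n) g (single_flag k) * single_weight k (x k).
Proof.
under eq_bigr do rewrite mulrDr; rewrite big_split /=; congr (_ + _).
  rewrite [RHS](partition_big (fun h => flags h x) xpredT) //=.
  by apply: eq_bigr => b _; rewrite mulr_sumr; apply: eq_bigr => h /andP[_ /eqP ->].
rewrite [RHS](partition_big single_flag xpredT) //=.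
apply: eq_bigr => b _; rewrite mulr_sumr.
by apply: eq_big => [k|k /eqP ->//]; rewrite eq_sym.
Qed.

Lemma model_ge0 x b : 0 <= model x b.
Proof.
by apply: addr_ge0; apply: sumr_ge0 => *; rewrite ?joint_weight_ge0 ?single_weight_ge0.
Qed.

Lemma model_total_le x : \sum_b model x b <= model_mass.
Proof.
under eq_bigr do rewrite -[model _ _]mul1r.
rewrite (model_sum (fun=> 1)); under eq_bigr do rewrite mul1r.
rewrite lerD2l; apply: ler_sum => k _; rewrite mul1r (bigD1 (x k)) //= lerDl.
by apply: sumr_ge0 => y _; exact: single_weight_ge0.
Qed.

(** A lone departing party meets one input at a time, so departing on both inputs is split into
    these two one-input departures. *)
Definition single_strategy (k : 'I_n) (y : 'Z_2) : {ffun 'I_n -> 'Z_2 * 'Z_2} :=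
  [ffun i => if i == k then if y == 0 then (1, 0) else (0, 1) else 0].

Lemma flags_single_strategy k y x :
  flags (single_strategy k y) x = if x k == y then single_flag k else 0.
Proof.
apply/ffunP => i; rewrite !ffunE; have [->|ik] := eqVneq i k; last first.
  by rewrite response0; case: ifP; rewrite ffunE ?(negPf ik).
by rewrite /response; have [->|->] := Z2P (x k); have [->|->] := Z2P y;
  rewrite /= ffunE ?eqxx.
Qed.

Section Payoff.
Variable g : bits n -> bits n -> R.
Hypothesis g0 : forall x, g x 0 = 0.

Definition payoff h := \sum_x g x (flags h x).

(** As [g x 0 = 0], a single strategy is paid only on the inputs with [x k = y], exactly where
    [model] uses its weight. *)
Lemma payoff_model : \sum_x \sum_b g x b * model x b =
  \sum_(h | multiple h) joint_weight h * payoff h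
  + \sum_(k < n) \sum_y single_weight k y * payoff (single_strategy k y).
Proof.
under eq_bigr do rewrite model_sum; rewrite big_split /=; congr (_ + _).
  rewrite exchange_big; apply: eq_bigr => h _; rewrite mulr_sumr.
  by apply: eq_bigr => x _; rewrite mulrC.
rewrite exchange_big; apply: eq_bigr => k _ /=.
rewrite (partition_big (fun x : bits n => x k) xpredT) //=; apply: eq_bigr => y _.
rewrite mulr_sumr big_mkcond; apply: eq_bigr => x _.
by rewrite flags_single_strategy; case: eqP => [->|_]; rewrite ?g0 ?mulr0 // mulrC.
Qed.

Lemma payoff_near_model :
  `|\sum_x \sum_b g x b * qprob x b - \sum_x \sum_b g x b * model x b|
   <= (\sum_x \sum_b `|g x b|) * (2 * n%:R * (s * departure)).
Proof.
rewrite -sumrB; apply: le_trans (ler_norm_sum _ _ _) _.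
rewrite mulr_suml; apply: ler_sum => x _.
rewrite -sumrB; apply: le_trans (ler_norm_sum _ _ _) _.
rewrite mulr_suml; apply: ler_sum => b _; rewrite -mulrBr normrM.
have [->|b0] := eqVneq b 0; first by rewrite g0 normr0 !mul0r.
by apply: ler_wpM2l => //; exact: qprob_near_model.
Qed.

End Payoff.

(** Each of the [2 * n] departure marginals is a probability of flagged strings, hence close to that
    of [model]. The bound involves [departure] again, to be absorbed for small [s]. *)
Lemma departure_le : departure <=
  2 * n%:R * (model_mass + #|{: bits n}|%:R * (2 * n%:R * (s * departure))).
Proof.
have E0 : 0 <= 2 * n%:R * (s * departure).
  by rewrite mulr_ge0 // ?mulr_ge0 // departure_ge0.
set E := 2 * n%:R * (s * departure) in E0 *.
have slot_le k y : L (set_slot (fun=> 1%:M) k (M k y 1))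
    <= model_mass + #|{: bits n}|%:R * E.
  pose x : bits n := [ffun=> y].
  have -> : y = x k by rewrite ffunE.
  rewrite (slot_measurement_expand rho M_meas) mulr_natl -sumr_const.
  apply: le_trans (lerD (model_total_le x) (lexx _)); rewrite -big_split /=.
  rewrite big_mkcond; apply: ler_sum => b _; case: eqP => [bk|_]; last first.
    by rewrite addr_ge0 // model_ge0.
  have b0 : b != 0 by apply: contra_eq_neq bk => ->; rewrite ffunE eq_sym oner_eq0.
  by have := qprob_near_model x b0; rewrite ler_norml lerBlDl => /andP[].
apply: le_trans (ler_sum _ (fun k _ => ler_sum _ (fun y _ => slot_le k y))) _.
by rewrite !sumr_const !card_ord -mulrnA -[leLHS]mulr_natl natrM lexx.
Qed.

(** The payoff of the model is at least [delta] times its mass. The departure is at most a multiple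
    of that mass, so the error, of order [s] times the departure, cannot exceed this payoff. *)
Lemma payoff_ge0 (g : bits n -> bits n -> R) (delta : R) :
  (0 < n)%N -> (forall x, g x 0 = 0) -> 0 <= delta ->
  (forall h, h != 0 -> delta <= payoff g h) ->
  8 * n%:R ^+ 2 * #|{: bits n}|%:R * s <= 1 ->
  8 * n%:R ^+ 2 * (\sum_x \sum_b `|g x b|) * s <= delta ->
  0 <= \sum_x \sum_b g x b * qprob x b.
Proof.
move=> n0 g0 delta0 gap sN sG.
have := payoff_near_model g0; rewrite payoff_model //.
have mass_le : delta * model_mass <= \sum_(h | multiple h) joint_weight h * payoff g h
  + \sum_(k < n) \sum_y single_weight k y * payoff g (single_strategy k y).
  rewrite mulrDr !mulr_sumr; apply: lerD; apply: ler_sum.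
    move=> h h_multi; rewrite mulrC ler_wpM2l ?joint_weight_ge0 //; apply: gap.
    apply: contraTneq h_multi => ->; rewrite negb_forall; apply/existsP.
    by exists (Ordinal n0); rewrite negb_exists; apply/forallP => j; rewrite ffunE eqxx andbF.
  move=> k _; rewrite mulr_sumr; apply: ler_sum => y _.
  rewrite mulrC ler_wpM2l ?single_weight_ge0 //; apply: gap.
  apply/eqP => /ffunP /(_ k); rewrite !ffunE eqxx.
  by case: ifP.
have T0 : 0 <= model_mass.
  apply: addr_ge0; apply: sumr_ge0 => *; rewrite ?joint_weight_ge0 //.
  by apply: sumr_ge0 => *; exact: single_weight_ge0.
have := departure_le; have := departure_ge0.
have G0 : 0 <= \sum_x \sum_b `|g x b| by apply: sumr_ge0 => x _; apply: sumr_ge0.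
move: G0 sG sN T0 mass_le; have := ler0n R n; have := ler0n R #|{: bits n}|.
(* [P] and [Q] will be the payoffs under [qprob] and [model], [T] the mass, [N] and [K] the numbers
   of parties and of strings. *)
move: s_ge0; move: (\sum_x \sum_b `|g x b|) (_ + _) model_mass departure n%:R (_%:R)
  (\sum_x \sum_b g x b * _).
clear -delta0 => G Q T eta N K P s0 K0 N0 G0 sG sN T0 massT eta0 eta_le.
rewrite ler_norml => /andP[PQ _].
(* By [sN] the feedback term [4 * N ^+ 2 * K * s * eta] is at most [eta / 2]. *)
have eta_le' : eta <= 4 * N * T.
  have : eta * (8 * N ^+ 2 * K * s) <= eta * 1 by exact: ler_wpM2l.
  lra.
(* The error is at most [8 * N ^+ 2 * G * s * T], hence at most [delta * T], a lower bound for
   [Q]. *)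
have : G * (2 * N * s) * eta <= G * (2 * N * s) * (4 * N * T).
  by apply: ler_wpM2l => //; rewrite !mulr_ge0.
have : 8 * N ^+ 2 * G * s * T <= delta * T by exact: ler_wpM2r.
lra.
Qed.

End Approximation.

(** * Pairs of projectors on a qubit *)

Section QubitProjectors.
Context {R : realType}.
Local Notation C := R[i].
Implicit Types A B E : 'M[C]_2.

Lemma orthogonal_projectorP A : orthogonal_projector A <-> A ^t* = A /\ A *m A = A.
Proof.
split=> -[AH AA]; split=> //; first exact: hermsymmx_adj.
by apply/is_hermitianmxP; rewrite expr0 scale1r AH.
Qed.

Lemma orthogonal_projectorM A B : orthogonal_projector A -> orthogonal_projector B ->
  A *m B = B *m A -> orthogonal_projector (A *m B).
Proof.
move=> /orthogonal_projectorP[AH AA] /orthogonal_projectorP[BH BB] AB.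
apply/orthogonal_projectorP; rewrite adjM AH BH -AB; split=> //.
by rewrite mulmxA -[A *m B *m A]mulmxA -AB mulmxA AA -mulmxA BB.
Qed.

(** Cayley-Hamilton in dimension two. *)
Lemma mx2_sqr A :
  A *m A = \tr A *: A - (A 0 0 * A 1 1 - A 0 1 * A 1 0)%:M.
Proof.
have sum2 (F : 'I_2 -> C) : \sum_j F j = F 0 + F 1 by exact: sum_Z2.
apply/matrixP => i j; rewrite !mxE /mxtrace !sum2.
by have [->|->] := Z2P i; have [->|->] := Z2P j; rewrite ?eqxx ?mulr1n ?mulr0n /=; ring.
Qed.

(** If the trace of [A] is not 1, Cayley-Hamilton makes [A] scalar, hence central. *)
Lemma noncommuting_projector_trace A B : A *m A = A -> A *m B <> B *m A -> \tr A = 1.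
Proof.
move=> AA AB; apply/eqP; apply: contra_notT AB => trA.
have := mx2_sqr A; rewrite AA; set d := (X in X%:M) => Ad.
have dA : \tr A *: A - A = d%:M.
  by apply/eqP; rewrite subr_eq [_ + A]addrC -subr_eq eq_sym; apply/eqP.
have -> : A = (d / (\tr A - 1))%:M.
  have tr0 : \tr A - 1 != 0 by rewrite subr_eq0.
  apply: (scalerI tr0); rewrite scale_scalar_mx mulrCA divff // mulr1 -dA.
  by rewrite scalerBl scale1r.
by rewrite mul_scalar_mx mul_mx_scalar.
Qed.

(** By Cayley-Hamilton the square is minus the determinant, which is real as a diagonal entry of
    [E ^t* *m E]. *)
Lemma traceless_hermitian_sqr E : E ^t* = E -> \tr E = 0 ->
  exists c : R, E *m E = (c%:C)%:M.
Proof.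
move=> EH trE; have := mx2_sqr E; rewrite trE scale0r sub0r -raddfN /=.
set c := - _ => EE; exists (complex.Re c); rewrite RRe_real //.
apply: ger0_real.
have -> : c = (E ^t* *m E) 0 0 by rewrite EH EE mxE eqxx mulr1n.
rewrite mxE; apply: sumr_ge0 => j _.
by rewrite !mxE mulrC mul_conjC_ge0.
Qed.

(** Commuting projectors have an exact joint measurement. Otherwise both departure projectors have
    rank one, and [c], the squared sine of their angle, decides: if it is small, the measurement of
    input 0 serves both inputs; if it is large, it bounds twice the sum of the departure projectors
    from below. *)
Lemma qubit_joint_approx (s : R) (M : 'Z_2 -> 'Z_2 -> 'M[C]_2) :
  0 < s -> (forall y b, orthogonal_projector (M y b)) ->
  (forall y, M y 0 + M y 1 = 1%:M) ->
  (exists W, joint_approx s M W) \/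
  exists2 c : R, s ^+ 2 < c &
    psd (M 0 1 + M 1 1 + (M 0 1 + M 1 1) - (c%:C)%:M).
Proof.
move=> s0 M_proj M_sum.
have M_meas : binary_measurements M by split=> // y b; exact: psd_projector.
have M0 y : M y 0 = 1%:M - M y 1 by rewrite -(M_sum y) addrK.
have [comm|ncomm] := eqVneq (M 0 1 *m M 1 1) (M 1 1 *m M 0 1).
  left; exists (fun c => M 0 c.1 *m M 1 c.2).
  have {}comm b : M 0 1 *m M 1 b = M 1 b *m M 0 1.
    have [->|->] := Z2P b; last exact: comm.
    by rewrite M0 mulmxBl mulmxBr mulmx1 mul1mx comm.
  have {}comm a b : M 0 a *m M 1 b = M 1 b *m M 0 a.
    have [->|->] := Z2P a; last exact: comm.
    by rewrite M0 mulmxBl mulmxBr mulmx1 mul1mx comm.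
  have margE y b : marginal (fun c => M 0 c.1 *m M 1 c.2) y b = M y b.
    rewrite /marginal big_mkcond sum_Z2xZ2 /response.
    have [->|->] := Z2P y; have [->|->] := Z2P b;
      by rewrite /= ?addr0 ?add0r -?mulmxDr -?mulmxDl M_sum ?mulmx1 ?mul1mx.
  split=> //.
  - by move=> c; apply/psd_projector/orthogonal_projectorM.
  - by rewrite sum_Z2xZ2 /= -!mulmxDr -mulmxDl !M_sum mulmx1.
  - by move=> y b; rewrite margE subrr addr0; apply: psd_scalar; exact: ltW.
  (* Inclusion-exclusion for commuting events. *)
  - have -> : M 0 1 + M 1 1 - (1%:M - M 0 0 *m M 1 0) = M 0 1 *m M 1 1.
      rewrite /= !M0 mulmxBl !mulmxBr !mulmx1 mul1mx.
      by move: (M 0 1 *m _) => Q; apply/matrixP => i j; rewrite !mxE; ring.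
    by apply/psd_projector/orthogonal_projectorM.
have /orthogonal_projectorP[H0 P0] := M_proj 0 1.
have /orthogonal_projectorP[H1 P1] := M_proj 1 1.
pose E := M 1 1 - M 0 1.
have EH : E ^t* = E by rewrite adjB H0 H1.
have trE : \tr E = 0.
  rewrite raddfB /= (noncommuting_projector_trace P0 (B := M 1 1)); last exact/eqP.
  rewrite (noncommuting_projector_trace P1 (B := M 0 1)) ?subrr //.
  by apply/eqP; rewrite eq_sym.
have [c EE] := traceless_hermitian_sqr EH trE.
have [cs|sc] := leP c (s ^+ 2); [left|right; exists c => //].
  have psdE b : psd ((s%:C)%:M + (M 1 b - M 0 b)).
    have [->|->] := Z2P b; last exact: (psd_scalarD EH EE).
    have -> : M 1 0 - M 0 0 = - E.
      by rewrite !M0; apply/matrixP => i j; rewrite !mxE; ring.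
    apply: (psd_scalarD _ _ s0 cs); last by rewrite mulNmx mulmxN opprK.
    by rewrite -sub0r adjB EH trmx0 map_mx0.
  (* The answer measured for input 0 is copied to both inputs. *)
  pose W (c : 'Z_2 * 'Z_2) := if c.1 == c.2 then M 0 c.1 else 0.
  have margE y b : marginal W y b = M 0 b.
    rewrite /marginal big_mkcond sum_Z2xZ2 /response /W.
    have [->|->] := Z2P y; have [->|->] := Z2P b;
      by rewrite /= ?addr0 ?add0r.
  exists W; split=> //.
  - by move=> d; rewrite /W; case: ifP => _; [exact: psd_projector | exact: psd0].
  - by rewrite sum_Z2xZ2 /W /= ?addr0 ?add0r.
  - move=> y b; rewrite margE; have [->|->] := Z2P y; last exact: psdE.
    by rewrite subrr addr0; apply: psd_scalar; exact: ltW.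
  - have -> : M 0 1 + M 1 1 - (1%:M - W 0) = M 1 1; last exact: psd_projector.
    by rewrite /W /= -(M_sum 0); apply/matrixP => i j; rewrite !mxE; ring.
(* [E^2 = c] reads [S^2 = 2 S - c] for [S = M 0 1 + M 1 1]. *)
have := psd_square (M 0 1 + M 1 1).
rewrite adjD H0 H1 -EE /E.
rewrite mulmxBl !mulmxBr mulmxDl !mulmxDr P0 P1.
congr psd; move: (M 0 1 *m M 1 1) (M 1 1 *m M 0 1) => A B.
by apply/matrixP => i j; rewrite !mxE; ring.
Qed.

End QubitProjectors.

(** * The gap of the unique classical maximum *)

Section Gap.
Context {R : realType} {n : nat}.
Implicit Types (beta p : bits_mx R n) (f : 'I_n -> 'Z_2 -> 'Z_2) (x b : bits n).
Implicit Types (h : {ffun 'I_n -> 'Z_2 * 'Z_2}).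

Definition outcome f x b : bits n := [ffun i => f i (x i) + b i].

Definition loss beta f x b : R :=
  entry beta (outcome f x 0) x - entry beta (outcome f x b) x.

Definition deviate f h (i : 'I_n) (y : 'Z_2) := f i y + response (h i) y.

Lemma loss0 beta f x : loss beta f x 0 = 0.
Proof. exact: subrr. Qed.

Lemma outcome_bij f x : bijective (outcome f x).
Proof.
exists (fun a : bits n => [ffun i => a i - f i (x i)]) => b; apply/ffunP => i; rewrite !ffunE.
  by rewrite addrAC subrr add0r.
by rewrite subrKC.
Qed.

Lemma bell_outcome beta f p : bell beta p =
  \sum_x \sum_b entry beta (outcome f x b) x * entry p (outcome f x b) x.
Proof.
rewrite /bell exchange_big; apply: eq_bigr => x _ /=.
by rewrite (reindex (outcome f x)) //; exact/onW_bij/outcome_bij.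
Qed.

(** Normalization spreads the deterministic value at [x] over all outcomes, to be compared term by
    term. *)
Lemma bell_loss beta f p :
  (forall x, \sum_b entry p (outcome f x b) x = 1) ->
  \sum_x entry beta (outcome f x 0) x - bell beta p
  = \sum_x \sum_b loss beta f x b * entry p (outcome f x b) x.
Proof.
move=> p1; rewrite (bell_outcome _ f) -sumrB; apply: eq_bigr => x _.
rewrite -[X in X - _]mulr1 -(p1 x) mulr_sumr -sumrB.
by apply: eq_bigr => b _; rewrite mulrBl.
Qed.

Lemma entry_det_corr f (a x : bits n) :
  entry (det_corr f : bits_mx R n) a x = (a == outcome f x 0)%:R.
Proof.
rewrite /entry mxE !enum_rankK; have [->|ax] := eqVneq.
  by rewrite big1 // => i _; rewrite !ffunE addr0 eqxx.
have /existsP[i ai] : [exists i, a i != f i (x i)].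
  apply: contraNT ax => /existsPn af; apply/eqP/ffunP => i; rewrite !ffunE addr0.
  by apply/eqP; rewrite -[_ == _]negbK; exact: af.
by rewrite (bigD1 i) //= (negPf ai) mul0r.
Qed.

Lemma bell_det_corr beta f :
  bell beta (det_corr f) = \sum_x entry beta (outcome f x 0) x.
Proof.
rewrite /bell exchange_big; apply: eq_bigr => x _ /=.
rewrite (bigD1 (outcome f x 0)) //= big1 => [|a /negPf ax].
  by rewrite entry_det_corr eqxx mulr1 addr0.
by rewrite entry_det_corr ax mulr0.
Qed.

Lemma outcome_deviate f h x : outcome (deviate f h) x 0 = outcome f x (flags h x).
Proof. by apply/ffunP => i; rewrite !ffunE addr0. Qed.

Lemma payoff_loss beta f h :
  payoff (loss beta f) h = bell beta (det_corr f) - bell beta (det_corr (deviate f h)).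
Proof.
rewrite !bell_det_corr -sumrB; apply: eq_bigr => x _.
by rewrite outcome_deviate.
Qed.

Lemma response_eq0 (c : 'Z_2 * 'Z_2) : (forall y, response c y = 0) -> c = 0.
Proof. by case: c => a b c0; have := c0 0; have := c0 1; rewrite /response /= => -> ->. Qed.

(** A nonzero [h] changes the answer of some party on some [y]; the constant input [y] exposes
    it. *)
Lemma det_corr_deviate f h : h != 0 -> det_corr (deviate f h) <> det_corr f :> bits_mx R n.
Proof.
move=> h0 /(congr1 (fun p => entry p)) eq_corr; case/eqP: h0; apply/ffunP => i.
rewrite ffunE; apply: response_eq0 => y; pose x : bits n := [ffun=> y].
have := congr1 (fun F => F (outcome (deviate f h) x 0) x) eq_corr.
rewrite !entry_det_corr eqxx; case: eqP => [/ffunP/(_ i)|_ /eqP]; last by rewrite oner_eq0.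
by rewrite !ffunE !addr0 -[RHS]addr0 => /addrI.
Qed.

Lemma payoff_gt0 beta f h : unique_classical_max beta f -> h != 0 ->
  0 < payoff (loss beta f) h.
Proof.
move=> f_max h0; rewrite payoff_loss subr_gt0; apply: f_max.
  by apply: sub_gen_smallest; exists (deviate f h).
exact: det_corr_deviate.
Qed.

(** There are finitely many strategies; the default 1 keeps the minimum positive even when no [h] is
    nonzero. *)
Lemma payoff_gap beta f : unique_classical_max beta f ->
  exists2 delta : R, 0 < delta & forall h, h != 0 -> delta <= payoff (loss beta f) h.
Proof.
move=> f_max; exists (\big[Num.min/1]_(h : {ffun 'I_n -> 'Z_2 * 'Z_2} | h != 0)
  payoff (loss beta f) h).
  by apply: lt_bigmin => // h; exact: payoff_gt0.
by move=> h h0; exact: bigmin_le_cond.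
Qed.

End Gap.

(** * Choice of the scale and proof of the theorem *)

Lemma small_scale (R : realType) (a b delta : R) : 0 <= a -> 0 <= b -> 0 < delta ->
  exists2 s, 0 < s & a * s <= 1 /\ b * s <= delta.
Proof.
move=> a0 b0 d0; have c0 : 0 < 1 + a + b / delta.
  by rewrite ltr_wpDr ?divr_ge0 // ?ltW // ltr_wpDr.
have bd0 : 0 <= b / delta by rewrite divr_ge0 // ltW.
exists (1 + a + b / delta)^-1; first by rewrite invr_gt0.
rewrite !ler_pdivrMr // mul1r; split; first lra.
have -> : delta * (1 + a + b / delta) = delta + delta * a + b.
  by field; rewrite gt_eqF.
by have := mulr_ge0 (ltW d0) a0; lra.
Qed.

Theorem lemma7 (R : realType) (n : nat) (beta : bits_mx R n)
    (f : 'I_n -> 'Z_2 -> 'Z_2) :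
  (1 <= n)%N -> unique_classical_max beta f -> local_optimum beta f.
Proof.
move=> n1 f_max; have [delta delta0 gap] := payoff_gap f_max.
have [] := @small_scale R (8 * n%:R ^+ 2 * #|{: bits n}|%:R)
  (8 * n%:R ^+ 2 * (\sum_x \sum_b `|loss beta f x b|)) delta _ _ delta0.
- by rewrite !mulr_ge0.
- by rewrite !mulr_ge0 //; apply: sumr_ge0 => x _; apply: sumr_ge0.
(* Here [4 * e = s ^+ 2], which will exclude the second alternative of [qubit_joint_approx]. *)
move=> s s0 [sN sG]; pose e := s ^+ 2 / 4.
have e0 : 0 < e by rewrite divr_gt0 ?exprn_gt0.
exists (ball (det_corr f) e); first exact: nbhsx_ballx.
move=> p [[rho [Pi [rho_state Pi_meas pE]]] [_ p_near]].
(* Outputs are relabelled so that flag 0 is the answer of [f]. *)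
pose M k y b := Pi k y (f k y + b).
have M_proj k y b : orthogonal_projector (M k y b).
  by have [P0 P1 _ _] := Pi_meas k y; rewrite /M; have [->|->] := Z2P (f k y + b).
have M_sum k y : M k y 0 + M k y 1 = 1%:M.
  have [_ _ P01 _] := Pi_meas k y; rewrite -P01 /M.
  have [->|->] := Z2P (f k y); rewrite ?add0r ?addr0 //.
  by rewrite (_ : 1 + 1 = 0 :> 'Z_2) 1?addrC //; exact: val_inj.
have M_meas k : binary_measurements (M k).
  by split=> // y b; exact: psd_projector.
have prob x b : entry p (outcome f x b) x = qprob rho M x b.
  have := congr1 (@complex.Re R) (pE (outcome f x b) x); rewrite /= => ->.
  rewrite /qprob /qexp; congr (complex.Re (\tr (_ *m tensor _))).
  by apply/funext => i; rewrite ffunE.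
have near x : 1 - qprob rho M x 0 < e.
  have := p_near (enum_rank (outcome f x 0)) (enum_rank x).
  rewrite -ball_normE /= => /(le_lt_trans (ler_norm _)).
  by rewrite -!/(entry _ _ _) prob entry_det_corr eqxx.
have slot_lt k y : qexp rho (set_slot (fun=> 1%:M) k (M k y 1)) < e.
  have -> : y = ([ffun=> y] : bits n) k by rewrite ffunE.
  exact: le_lt_trans (slot_le_complement rho_state M_meas _ _) (near _).
have W_ex k : exists W, joint_approx s (M k) W.
  have [//|[c sc far]] := qubit_joint_approx s0 (M_proj k) (M_sum k).
  (* In the state, [far] bounds [c] by twice the sum of two departure probabilities, hence by less
     than [4 * e], against [sc]. *)
  have : 0 <= qexp rho (set_slot (fun=> 1%:M) k
      (M k 0 1 + M k 1 1 + (M k 0 1 + M k 1 1) - (c%:C)%:M)).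
    apply: qexp_ge0 => // i; rewrite /set_slot; case: eqP => _ //; exact: psd1.
  rewrite qexp_slotB !qexp_slotD -(scalemx1 _ c%:C) qexp_slotZ.
  rewrite [set_slot _ k 1%:M](set_slot_id (fun=> 1%:M)) qexp1 // mulr1.
  by have := slot_lt k 0; have := slot_lt k 1; rewrite /e; lra.
have [W MW] := choice W_ex.
have total x : \sum_b entry p (outcome f x b) x = 1.
  by rewrite -(qprob_total rho_state M_meas x); apply: eq_bigr => b _; exact: prob.
rewrite -subr_ge0 bell_det_corr bell_loss //.
under eq_bigr do under eq_bigr do rewrite prob.
apply: (payoff_ge0 rho_state (ltW s0) MW n1 (delta := delta)) => //.
- exact: loss0.
- exact: ltW.
Qed.
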